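(* Let $\mathcal T$ be a locally finite triangulated category and $F$ an autoequivalence of $\mathcal T$ such that $\mathcal O_F:=\mathcal T/F$ is a triangulated category and $\pi_F:\mathcal T\rightarrow \mathcal O_F$ is a triangle functor. Let $m\ge1$. If $\mathcal X$ is an $F$-periodic $m$-cluster tilting subcategory of $\mathcal T$, then $\mathcal Y:=\pi_F(\mathcal X)$ is an $m$-cluster tilting subcategory of $\mathcal O_F$.
   Context: A triangulated category $\mathcal T$ (with suspension $\Sigma$) is locally finite if for every indecomposable object $X$ there are only finitely many isomorphism classes of indecomposable objects $Y$ with $\mathrm{Hom}_{\mathcal T}(X,Y)\neq 0$ (the dual condition is then automatic). The orbit category $\mathcal O_F=\mathcal T/F$ has the same objects as $\mathcal T$ and morphisms $\mathrm{Hom}_{\mathcal O_F}(X,Y)=\bigoplus_{p\in\mathbb Z}\mathrm{Hom}_{\mathcal T}(X,F^pY)$; $\pi_F$ is the natural projection. Subcategories are full and closed under isomorphism. Write $\mathrm{Ext}^i(X,Y)=\mathrm{Hom}(X,\Sigma^iY)$. A subcategory $\mathcal X$ of a triangulated category $\mathcal C$ is $m$-cluster tilting if it is functorially finite (both covariantly and contravariantly finite) and $$\mathcal X=\{Z\in\mathcal C\mid \mathrm{Ext}^i_{\mathcal C}(\mathcal X,Z)=0\text{ for }0<i<m\}=\{Z\in\mathcal C\mid \mathrm{Ext}^i_{\mathcal C}(Z,\mathcal X)=0\text{ for }0<i<m\}.$$ $\mathcal X$ is $F$-periodic if $F\mathcal X=\mathcal X$. *)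

(* Defs.v *)
From HB Require Import structures.
From mathcomp Require Import all_boot all_order all_algebra finmap.
From mathcomp Require Import boolp classical_sets functions cardinality fsbigop.
From mathcomp Require Import zify.

Set Implicit Arguments.
Unset Strict Implicit.
Unset Printing Implicit Defensive.

Import GRing.Theory.
Local Open Scope ring_scope.

Record preadditive := Preadditive {
  ob :> Type;
  hom : ob -> ob -> zmodType;
  idm : forall X, hom X X;
  hcomp : forall X Y Z, hom Y Z -> hom X Y -> hom X Z;
  compA : forall X Y Z W (h : hom Z W) (g : hom Y Z) (f : hom X Y),
    hcomp h (hcomp g f) = hcomp (hcomp h g) f;
  comp1m : forall X Y (f : hom X Y), hcomp (idm Y) f = f;
  compm1 : forall X Y (f : hom X Y), hcomp f (idm X) = f;
  compDl : forall X Y Z (g g' : hom Y Z) (f : hom X Y),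
    hcomp (g + g') f = hcomp g f + hcomp g' f;
  compDr : forall X Y Z (g : hom Y Z) (f f' : hom X Y),
    hcomp g (f + f') = hcomp g f + hcomp g f'
}.

Arguments hom {p} X Y.
Arguments idm {p} X.
Arguments hcomp {p X Y Z} g f.

Notation "g \c f" := (hcomp g f) (at level 40, left associativity).

Definition is_iso (C : preadditive) (X Y : C) (f : hom X Y) : Prop :=
  exists g : hom Y X, g \c f = idm X /\ f \c g = idm Y.

Definition isomorphic (C : preadditive) (X Y : C) : Prop :=
  exists f : hom X Y, is_iso f.

Definition is_zero (C : preadditive) (X : C) : Prop := idm X = 0.

Definition is_biproduct (C : preadditive) (A B S : C) : Prop :=
  exists (i : hom A S) (j : hom B S) (p : hom S A) (q : hom S B),
    [/\ p \c i = idm A, q \c j = idm B, p \c j = 0, q \c i = 0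
      & i \c p + j \c q = idm S].

Definition is_additive (C : preadditive) : Prop :=
  (exists X : C, is_zero X) /\ forall A B : C, exists S, is_biproduct A B S.

Definition indecomposable (C : preadditive) (X : C) : Prop :=
  ~ is_zero X /\ forall A B : C, is_biproduct A B X -> is_zero A \/ is_zero B.

Definition locally_finite (C : preadditive) : Prop :=
  forall X : C, indecomposable X ->
  exists (n : nat) (L : 'I_n -> C), forall Y : C, indecomposable Y ->
    (exists f : hom X Y, f <> 0) -> exists i, isomorphic Y (L i).

Record additive_functor (C D : preadditive) := AdditiveFunctor {
  fob :> C -> D;
  fmap : forall X Y, hom X Y -> hom (fob X) (fob Y);
  fmap1 : forall X, fmap (idm X) = idm (fob X);
  fmapM : forall X Y Z (g : hom Y Z) (f : hom X Y),
    fmap (g \c f) = fmap g \c fmap f;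
  fmapD : forall X Y (f g : hom X Y), fmap (f + g) = fmap f + fmap g
}.

Arguments fmap {C D} a {X Y} f.

Definition id_functor (C : preadditive) : additive_functor C C :=
  @AdditiveFunctor C C (fun X => X) (fun X Y f => f)
    (fun X => erefl) (fun X Y Z g f => erefl) (fun X Y f g => erefl).

Section CompFunctor.
Variables (C D E : preadditive).
Variables (Q : additive_functor D E) (P : additive_functor C D).

Definition comp_functor : additive_functor C E.
Proof.
refine (@AdditiveFunctor C E (fun X => Q (P X))
          (fun X Y f => fmap Q (fmap P f)) _ _ _).
- by move=> X; rewrite !fmap1.
- by move=> X Y Z g f; rewrite !fmapM.
- by move=> X Y f g; rewrite !fmapD.
Defined.

End CompFunctor.

Fixpoint fiter (C : preadditive) (P : additive_functor C C) (n : nat) :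
    additive_functor C C :=
  if n is n'.+1 then comp_functor P (fiter P n') else id_functor C.

Record nat_iso (C D : preadditive) (P Q : additive_functor C D) := NatIso {
  niso :> forall X, hom (P X) (Q X);
  nisoV : forall X, hom (Q X) (P X);
  niso_nat : forall X Y (f : hom X Y),
    niso Y \c fmap P f = fmap Q f \c niso X;
  nisoK : forall X, nisoV X \c niso X = idm (P X);
  nisoVK : forall X, niso X \c nisoV X = idm (Q X)
}.

(* An adjoint equivalence: any equivalence together with a quasi-inverse can be
   completed to such data, and the triangle identities are what makes the
   canonical isomorphisms F^p F^q = F^(p+q) below coherent. *)
Record autoequivalence (C : preadditive) := Autoequivalence {
  aeq :> additive_functor C C;
  aeqV : additive_functor C C;
  aeq_unit : nat_iso (id_functor C) (comp_functor aeqV aeq);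
  aeq_counit : nat_iso (comp_functor aeq aeqV) (id_functor C);
  aeq_triangle : forall X,
    aeq_counit (aeq X) \c fmap aeq (aeq_unit X) = idm (aeq X);
  aeqV_triangle : forall X,
    fmap aeqV (aeq_counit X) \c aeq_unit (aeqV X) = idm (aeqV X)
}.

Record triangulation (C : preadditive) := Triangulation {
  tri_additive : is_additive C;
  Susp : autoequivalence C;
  dist : forall X Y Z : C,
    hom X Y -> hom Y Z -> hom Z (Susp X) -> Prop;
  dist_iso : forall (X Y Z X' Y' Z' : C)
    (f : hom X Y) (g : hom Y Z) (h : hom Z (Susp X))
    (f' : hom X' Y') (g' : hom Y' Z') (h' : hom Z' (Susp X'))
    (a : hom X X') (b : hom Y Y') (c : hom Z Z'),
    is_iso a -> is_iso b -> is_iso c ->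
    b \c f = f' \c a -> c \c g = g' \c b -> fmap Susp a \c h = h' \c c ->
    dist f g h -> dist f' g' h';
  dist_id : forall X Z : C, is_zero Z ->
    dist (idm X) (0 : hom X Z) (0 : hom Z (Susp X));
  dist_cone : forall (X Y : C) (f : hom X Y),
    exists (Z : C) (g : hom Y Z) (h : hom Z (Susp X)), dist f g h;
  dist_rot : forall (X Y Z : C)
    (f : hom X Y) (g : hom Y Z) (h : hom Z (Susp X)),
    dist f g h <-> dist g h (- fmap Susp f);
  dist_mor : forall (X Y Z X' Y' Z' : C)
    (f : hom X Y) (g : hom Y Z) (h : hom Z (Susp X))
    (f' : hom X' Y') (g' : hom Y' Z') (h' : hom Z' (Susp X'))
    (a : hom X X') (b : hom Y Y'),
    dist f g h -> dist f' g' h' -> b \c f = f' \c a ->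
    exists c : hom Z Z', c \c g = g' \c b /\ fmap Susp a \c h = h' \c c;
  dist_oct : forall (X Y Z U V W : C) (f : hom X Y) (g : hom Y Z)
    (f1 : hom Y U) (f2 : hom U (Susp X))
    (k1 : hom Z V) (k2 : hom V (Susp X))
    (g1 : hom Z W) (g2 : hom W (Susp Y)),
    dist f f1 f2 -> dist (g \c f) k1 k2 -> dist g g1 g2 ->
    exists (a : hom U V) (b : hom V W),
      [/\ dist a b (fmap Susp f1 \c g2),
          a \c f1 = k1 \c g /\ k2 \c a = f2
        & b \c k1 = g1 /\ g2 \c b = fmap Susp f \c k2]
}.

Definition is_triangle_functor (C D : preadditive)
    (tC : triangulation C) (tD : triangulation D)
    (P : additive_functor C D) : Prop :=
  exists phi : nat_iso (comp_functor P (Susp tC)) (comp_functor (Susp tD) P),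
  forall (X Y Z : C) (f : hom X Y) (g : hom Y Z) (h : hom Z (Susp tC X)),
    dist f g h -> dist (fmap P f) (fmap P g) (phi X \c fmap P h).

(* A full subcategory closed under isomorphism, given by its objects. *)
Record subcategory (C : preadditive) := Subcategory {
  subcat_mem :> C -> Prop;
  subcat_iso : forall X Y : C, isomorphic X Y -> subcat_mem X -> subcat_mem Y
}.

Lemma isomorphic_sym (C : preadditive) (X Y : C) :
  isomorphic X Y -> isomorphic Y X.
Proof. by move=> [f [g [gf fg]]]; exists g, f. Qed.

Lemma isomorphic_trans (C : preadditive) (X Y Z : C) :
  isomorphic X Y -> isomorphic Y Z -> isomorphic X Z.
Proof.
move=> [f [f' [f'f ff']]] [g [g' [g'g gg']]]; exists (g \c f), (f' \c g').
by split; rewrite compA -[_ \c _ \c _ \c _]compA -compA;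
   rewrite ?[g' \c (g \c f)]compA ?[f \c (f' \c g')]compA
           ?g'g ?ff' ?comp1m ?f'f.
Qed.

Section Image.
Variables (C D : preadditive) (P : additive_functor C D) (X : subcategory C).

Definition image_subcategory : subcategory D.
Proof.
refine (@Subcategory D (fun Z => exists2 A : C, X A & isomorphic (P A) Z) _).
move=> Y Z YZ [A XA AY]; exists A => //; exact: isomorphic_trans YZ.
Defined.

End Image.

Definition periodic (C : preadditive) (F : additive_functor C C)
    (X : subcategory C) : Prop :=
  forall Z : C, image_subcategory F X Z <-> X Z.

Definition contravariantly_finite (C : preadditive) (X : subcategory C) : Prop :=
  forall Z : C, exists (A : C) (f : hom A Z), X A /\
    forall (B : C) (g : hom B Z), X B -> exists h : hom B A, g = f \c h.

Definition covariantly_finite (C : preadditive) (X : subcategory C) : Prop :=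
  forall Z : C, exists (A : C) (f : hom Z A), X A /\
    forall (B : C) (g : hom Z B), X B -> exists h : hom A B, g = h \c f.

Definition functorially_finite (C : preadditive) (X : subcategory C) : Prop :=
  contravariantly_finite X /\ covariantly_finite X.

Definition Ext (C : preadditive) (tC : triangulation C) (i : nat) (X Y : C) :
  zmodType := hom X (fiter (Susp tC) i Y).

Definition cluster_tilting (C : preadditive) (tC : triangulation C) (m : nat)
    (X : subcategory C) : Prop :=
  [/\ functorially_finite X,
      forall Z : C, X Z <->
        forall i, (0 < i < m)%N -> forall A, X A -> forall e : Ext tC i A Z, e = 0
    & forall Z : C, X Z <->
        forall i, (0 < i < m)%N -> forall A, X A -> forall e : Ext tC i Z A, e = 0].

Section DirectSum.
Variables (I : choiceType) (A : I -> zmodType).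

Record dsum := DSum {
  dsum_val :> forall i, A i;
  dsum_fin : exists S : {fset I}, forall i, i \notin S -> dsum_val i = 0
}.

Lemma dsum_eq (x y : dsum) : (forall i, x i = y i) -> x = y.
Proof.
case: x y => [x xf] [y yf] /= xy.
have exy : x = y by apply: functional_extensionality_dep.
by case: _ / exy yf {xy} => yf; congr DSum; exact: Prop_irrelevance.
Qed.

HB.instance Definition _ := gen_eqMixin dsum.
HB.instance Definition _ := gen_choiceMixin dsum.

Definition dsum0 : dsum.
Proof. by exists (fun=> 0); exists fset0. Defined.

Definition dsum_opp (x : dsum) : dsum.
Proof.
exists (fun i => - x i); case: (dsum_fin x) => S xS.
by exists S => i /xS ->; rewrite oppr0.
Defined.

Definition dsum_add (x y : dsum) : dsum.
Proof.
exists (fun i => x i + y i).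
case: (dsum_fin x) (dsum_fin y) => [S xS] [S' yS'].
exists (S `|` S')%fset => i; rewrite inE negb_or => /andP[/xS -> /yS' ->].
by rewrite addr0.
Defined.

Lemma dsum_addA : associative dsum_add.
Proof. by move=> x y z; apply: dsum_eq => i /=; rewrite addrA. Qed.

Lemma dsum_addC : commutative dsum_add.
Proof. by move=> x y; apply: dsum_eq => i /=; rewrite addrC. Qed.

Lemma dsum_add0 : left_id dsum0 dsum_add.
Proof. by move=> x; apply: dsum_eq => i /=; rewrite add0r. Qed.

Lemma dsum_addN : left_inverse dsum0 dsum_opp dsum_add.
Proof. by move=> x; apply: dsum_eq => i /=; rewrite addNr. Qed.

HB.instance Definition _ :=
  GRing.isZmodule.Build dsum dsum_addA dsum_addC dsum_add0 dsum_addN.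

Definition dsum_single_val (i : I) (a : A i) (j : I) : A j :=
  if i =P j is ReflectT e then ecast j (A j) e a else 0.

Lemma dsum_single_valE i (a : A i) : dsum_single_val a i = a.
Proof.
by rewrite /dsum_single_val; case: eqP => // e; rewrite eq_axiomK.
Qed.

Lemma dsum_single_val_neq i (a : A i) j : i != j -> dsum_single_val a j = 0.
Proof. by rewrite /dsum_single_val; case: eqP. Qed.

Definition dsum_single (i : I) (a : A i) : dsum.
Proof.
exists (dsum_single_val a); exists [fset i]%fset => j.
by rewrite inE eq_sym; exact: dsum_single_val_neq.
Defined.

Lemma dsum_valD (x y : dsum) i : (x + y) i = x i + y i.
Proof. by []. Qed.

Lemma dsum_val0 i : (0 : dsum) i = 0.
Proof. by []. Qed.

Lemma dsum_singleD i (a b : A i) :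
  dsum_single (a + b) = dsum_single a + dsum_single b.
Proof.
apply: dsum_eq => j; rewrite dsum_valD /=.
have [<-|ij] := eqVneq i j; first by rewrite !dsum_single_valE.
by rewrite !dsum_single_val_neq // addr0.
Qed.

Lemma dsum_single0 i : dsum_single (0 : A i) = 0.
Proof.
apply: (@addrI _ (dsum_single (0 : A i))).
by rewrite -dsum_singleD !addr0.
Qed.

Lemma dsum_sumE (S : seq I) (G : I -> dsum) j :
  (\sum_(i <- S) G i) j = \sum_(i <- S) G i j.
Proof.
by elim: S => [|i S IH]; rewrite ?big_nil // !big_cons dsum_valD IH.
Qed.

Lemma dsum_decomp (x : dsum) (S : {fset I}) :
  (forall i, i \notin S -> x i = 0) -> x = \sum_(i <- S) dsum_single (x i).
Proof.
move=> xS; apply: dsum_eq => j; rewrite dsum_sumE /=.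
have [jS|jS] := boolP (j \in S).
  rewrite (big_fsetD1 j) //= dsum_single_valE big_seq big1 ?addr0 // => i.
  by rewrite !inE => /andP[ij _]; rewrite dsum_single_val_neq.
rewrite xS // big_seq big1 // => i iS; apply: dsum_single_val_neq.
by apply: contraNneq jS => <-.
Qed.

Lemma dsum_ind (P : dsum -> Prop) :
  P 0 -> (forall x y, P x -> P y -> P (x + y)) ->
  (forall i (a : A i), P (dsum_single a)) -> forall x, P x.
Proof.
move=> P0 PD P1 x; case: (dsum_fin x) => S /dsum_decomp ->.
by elim/big_ind: _.
Qed.

End DirectSum.

Arguments dsum_single {I A} i a.

Section Zeros.
Variables (C D : preadditive) (P : additive_functor C D).

Lemma comp0m (X Y Z : C) (f : hom X Y) : (0 : hom Y Z) \c f = 0.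
Proof. by apply: (@addrI _ ((0 : hom Y Z) \c f)); rewrite -compDl !addr0. Qed.

Lemma compm0 (X Y Z : C) (g : hom Y Z) : g \c (0 : hom X Y) = 0.
Proof. by apply: (@addrI _ (g \c (0 : hom X Y))); rewrite -compDr !addr0. Qed.

Lemma fmap0 (X Y : C) : fmap P (0 : hom X Y) = 0.
Proof. by apply: (@addrI _ (fmap P (0 : hom X Y))); rewrite -fmapD !addr0. Qed.

End Zeros.

Definition succz (p : int) : int :=
  match p with Posz n => Posz n.+1 | Negz 0 => Posz 0 | Negz n.+1 => Negz n end.

Definition predz (p : int) : int :=
  match p with Posz 0 => Negz 0 | Posz n.+1 => Posz n | Negz n => Negz n.+1 end.

Lemma succzE p : succz p = 1 + p.
Proof. by case: p => [n|[|n]]; rewrite ?NegzE /= /succz; lia. Qed.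

Lemma predzE p : predz p = -1 + p.
Proof. by case: p => [[|n]|n]; rewrite ?NegzE /= /predz; lia. Qed.

Lemma succzK p : predz (succz p) = p.
Proof. by case: p => [n|[|n]]. Qed.

Lemma predzK p : succz (predz p) = p.
Proof. by case: p => [[|n]|n]. Qed.

(* shiftz p q is p + q, computed by recursion on p *)
Definition shiftz (p q : int) : int :=
  match p with Posz n => iter n succz q | Negz n => iter n.+1 predz q end.

Lemma iter_succz n q : iter n succz q = n%:Z + q.
Proof. by elim: n => [|n IH]; rewrite ?add0r //= IH succzE addrA -intS. Qed.

Lemma iter_predz n q : iter n predz q = - n%:Z + q.
Proof.
elim: n => [|n IH]; first by rewrite oppr0 add0r.
by rewrite /= IH predzE addrA intS opprD.
Qed.

Lemma shiftzE p q : shiftz p q = p + q.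
Proof. by case: p => n; rewrite /shiftz ?iter_succz // iter_predz NegzE. Qed.

Section Powers.
Variables (C : preadditive) (F : autoequivalence C).
Implicit Types (p q r : int) (X Y Z : C).

Local Notation F' := (aeqV F).
Local Notation cou := (aeq_counit F).
Local Notation etaV := (nisoV (aeq_unit F)).

Definition fpow p : additive_functor C C :=
  match p with Posz n => fiter F n | Negz n => fiter F' n.+1 end.

Definition pcast p q (e : p = q) X : hom (fpow p X) (fpow q X) :=
  ecast z (hom (fpow p X) (fpow z X)) e (idm (fpow p X)).

(* F F^p -> F^(p+1): the counit if p < 0, the identity otherwise *)
Definition fstep p X : hom (F (fpow p X)) (fpow (succz p) X) :=
  match p return hom (F (fpow p X)) (fpow (succz p) X) with
  | Posz n => idm (fpow (Posz n.+1) X)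
  | Negz n =>
    match n return hom (F (fpow (Negz n) X)) (fpow (succz (Negz n)) X) with
    | O => cou X
    | n'.+1 => cou (fpow (Negz n') X)
    end
  end.

(* F^-1 F^p -> F^(p-1): the inverse of the unit if p > 0, the identity
   otherwise *)
Definition gstep p X : hom (F' (fpow p X)) (fpow (predz p) X) :=
  match p return hom (F' (fpow p X)) (fpow (predz p) X) with
  | Posz n =>
    match n return hom (F' (fpow (Posz n) X)) (fpow (predz (Posz n)) X) with
    | O => idm (F' X)
    | n'.+1 => etaV (fpow (Posz n') X)
    end
  | Negz n => idm (fpow (Negz n.+1) X)
  end.

Fixpoint muP n q X : hom (fiter F n (fpow q X)) (fpow (iter n succz q) X) :=
  match n return hom (fiter F n (fpow q X)) (fpow (iter n succz q) X) with
  | O => idm (fpow q X)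
  | n'.+1 => fstep (iter n' succz q) X \c fmap F (muP n' q X)
  end.

Fixpoint muN n q X : hom (fiter F' n (fpow q X)) (fpow (iter n predz q) X) :=
  match n return hom (fiter F' n (fpow q X)) (fpow (iter n predz q) X) with
  | O => idm (fpow q X)
  | n'.+1 => gstep (iter n' predz q) X \c fmap F' (muN n' q X)
  end.

Definition mu p q X : hom (fpow p (fpow q X)) (fpow (shiftz p q) X) :=
  match p return hom (fpow p (fpow q X)) (fpow (shiftz p q) X) with
  | Posz n => muP n q X
  | Negz n => muN n.+1 q X
  end.

(* The canonical isomorphism F^p F^q -> F^(p+q). *)
Definition fpowD p q X : hom (fpow p (fpow q X)) (fpow (p + q) X) :=
  pcast (shiftzE p q) X \c mu p q X.

Lemma pcast1 p (e : p = p) X : pcast e X = idm (fpow p X).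
Proof. by rewrite (eq_axiomK e). Qed.

Lemma pcastM p q r (e : p = q) (e' : q = r) X :
  pcast e' X \c pcast e X = pcast (etrans e e') X.
Proof. by case: _ / e'; rewrite /= comp1m. Qed.

Lemma pcast_nat p q (e : p = q) X Y (f : hom X Y) :
  pcast e Y \c fmap (fpow p) f = fmap (fpow q) f \c pcast e X.
Proof. by case: _ / e; rewrite /= comp1m compm1. Qed.

Lemma fstep_cast p q (e : p = q) (e' : succz p = succz q) X :
  fstep q X \c fmap F (pcast e X) = pcast e' X \c fstep p X.
Proof. by case: _ / e e' => e'; rewrite !pcast1 fmap1 compm1 comp1m. Qed.

Lemma gstep_cast p q (e : p = q) (e' : predz p = predz q) X :
  gstep q X \c fmap F' (pcast e X) = pcast e' X \c gstep p X.
Proof. by case: _ / e e' => e'; rewrite !pcast1 fmap1 compm1 comp1m. Qed.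

Lemma cou_nat X Y (f : hom X Y) : cou Y \c fmap F (fmap F' f) = f \c cou X.
Proof. exact: (niso_nat cou f). Qed.

Lemma etaV_nat X Y (f : hom X Y) : etaV Y \c fmap F' (fmap F f) = f \c etaV X.
Proof.
have /= nf := niso_nat (aeq_unit F) f.
rewrite -[RHS]comp1m -(nisoK (aeq_unit F) Y) -[RHS]compA.
rewrite (compA _ f) nf -(compA _ _ (etaV X)).
by have /= -> := nisoVK (aeq_unit F) X; rewrite compm1.
Qed.

Lemma F_etaV X : fmap F (etaV X) = cou (F X).
Proof.
rewrite -[LHS]comp1m -(aeq_triangle F X) -compA -fmapM nisoVK /=.
by rewrite fmap1 compm1.
Qed.

Lemma F'_cou X : fmap F' (cou X) = etaV (F' X).
Proof.
rewrite -[RHS]comp1m -(aeqV_triangle F X) -compA nisoVK /=.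
by rewrite compm1.
Qed.

Lemma fstep_nat p X Y (f : hom X Y) :
  fstep p Y \c fmap F (fmap (fpow p) f) = fmap (fpow (succz p)) f \c fstep p X.
Proof.
case: p => [n|[|n]] /=; first by rewrite comp1m compm1.
  exact: cou_nat.
exact: cou_nat.
Qed.

Lemma gstep_nat p X Y (f : hom X Y) :
  gstep p Y \c fmap F' (fmap (fpow p) f) = fmap (fpow (predz p)) f \c gstep p X.
Proof.
case: p => [[|n]|n] /=; rewrite ?comp1m ?compm1 //.
exact: etaV_nat.
Qed.

Lemma muP_nat n q X Y (f : hom X Y) :
  muP n q Y \c fmap (fiter F n) (fmap (fpow q) f)
  = fmap (fpow (iter n succz q)) f \c muP n q X.
Proof.
elim: n => [|n IH] /=; first by rewrite comp1m compm1.
by rewrite -compA -fmapM IH fmapM !compA fstep_nat.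
Qed.

Lemma muN_nat n q X Y (f : hom X Y) :
  muN n q Y \c fmap (fiter F' n) (fmap (fpow q) f)
  = fmap (fpow (iter n predz q)) f \c muN n q X.
Proof.
elim: n => [|n IH]; first by rewrite /= comp1m compm1.
by rewrite /= -compA -fmapM IH fmapM !compA gstep_nat.
Qed.

Lemma mu_nat p q X Y (f : hom X Y) :
  mu p q Y \c fmap (fpow p) (fmap (fpow q) f)
  = fmap (fpow (shiftz p q)) f \c mu p q X.
Proof. by case: p => n; [exact: muP_nat | exact: (muN_nat n.+1)]. Qed.

Lemma gstep_fstep p (e : p = predz (succz p)) X :
  gstep (succz p) X \c fmap F' (fstep p X) = pcast e X \c etaV (fpow p X).
Proof.
by case: p e => [n|[|n]] /= e;
  rewrite pcast1 /= ?fmap1 ?comp1m ?compm1 ?F'_cou.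
Qed.

Lemma fstep_gstep p (e : p = succz (predz p)) X :
  fstep (predz p) X \c fmap F (gstep p X) = pcast e X \c cou (fpow p X).
Proof.
by case: p e => [[|n]|n] /= e;
  rewrite pcast1 /= ?fmap1 ?comp1m ?compm1 ?F_etaV.
Qed.

Lemma mu_fstep p q (e : succz (shiftz p q) = shiftz (succz p) q) X :
  mu (succz p) q X \c fstep p (fpow q X)
  = pcast e X \c fstep (shiftz p q) X \c fmap F (mu p q X).
Proof.
case: p e => [n|n] e; first by rewrite /= pcast1 compm1 comp1m.
have e1 : iter n predz q = succz (predz (iter n predz q)) by rewrite predzK.
rewrite [mu (Negz n) _ _]/= fmapM -compA (compA _ (fmap F (gstep _ _))).
rewrite (fstep_gstep e1) -(compA (pcast e1 X)) cou_nat !compA pcastM.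
case: n e e1 => [|n] e e1 /=; first by rewrite pcast1 !comp1m.
by rewrite pcast1 !comp1m.
Qed.

Lemma mu_gstep p q (e : predz (shiftz p q) = shiftz (predz p) q) X :
  mu (predz p) q X \c gstep p (fpow q X)
  = pcast e X \c gstep (shiftz p q) X \c fmap F' (mu p q X).
Proof.
case: p e => [n|n] e; last by rewrite /= pcast1 compm1 comp1m.
case: n e => [|n] e.
  by rewrite /= pcast1 compm1 comp1m.
have e1 : iter n succz q = predz (succz (iter n succz q)) by rewrite succzK.
rewrite [mu (Posz n.+1) _ _]/= fmapM -compA (compA _ (fmap F' (fstep _ _))).
rewrite (gstep_fstep e1) -(compA (pcast e1 X)) etaV_nat !compA pcastM.
by rewrite pcast1 !comp1m.
Qed.

Lemma muP_assoc n q r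
    (e : iter n succz (shiftz q r) = shiftz (iter n succz q) r) X :
  mu (iter n succz q) r X \c muP n q (fpow r X)
  = pcast e X \c muP n (shiftz q r) X \c fmap (fiter F n) (mu q r X).
Proof.
elim: n e => [|n IH] e; first by rewrite /= pcast1 compm1 !comp1m.
have e1 : iter n succz (shiftz q r) = shiftz (iter n succz q) r.
  by rewrite !iter_succz !shiftzE addrA.
have e2 : succz (shiftz (iter n succz q) r) = shiftz (iter n.+1 succz q) r.
  by rewrite -e -e1.
have e3 : succz (iter n succz (shiftz q r)) = succz (shiftz (iter n succz q) r).
  by rewrite e1.
rewrite /= compA (mu_fstep e2) -compA -fmapM (IH e1) !fmapM !compA.
by rewrite -(compA _ (fstep _ _)) (fstep_cast _ e3) compA pcastM
           (eq_irrelevance (etrans e3 e2) e).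
Qed.

Lemma muN_assoc n q r
    (e : iter n predz (shiftz q r) = shiftz (iter n predz q) r) X :
  mu (iter n predz q) r X \c muN n q (fpow r X)
  = pcast e X \c muN n (shiftz q r) X \c fmap (fiter F' n) (mu q r X).
Proof.
elim: n e => [|n IH] e; first by rewrite /= pcast1 compm1 !comp1m.
have e1 : iter n predz (shiftz q r) = shiftz (iter n predz q) r.
  by rewrite !iter_predz !shiftzE addrA.
have e2 : predz (shiftz (iter n predz q) r) = shiftz (iter n.+1 predz q) r.
  by rewrite -e -e1.
have e3 : predz (iter n predz (shiftz q r)) = predz (shiftz (iter n predz q) r).
  by rewrite e1.
rewrite /= compA (mu_gstep e2) -compA -fmapM (IH e1) !fmapM !compA.
by rewrite -(compA _ (gstep _ _)) (gstep_cast _ e3) compA pcastM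
           (eq_irrelevance (etrans e3 e2) e).
Qed.

Lemma mu_assoc p q r (e : shiftz p (shiftz q r) = shiftz (shiftz p q) r) X :
  mu (shiftz p q) r X \c mu p q (fpow r X)
  = pcast e X \c mu p (shiftz q r) X \c fmap (fpow p) (mu q r X).
Proof.
by case: p e => n e; [exact: muP_assoc | exact: (@muN_assoc n.+1)].
Qed.

Lemma muP0 n (e : Posz n = iter n succz 0) X : muP n 0 X = pcast e X.
Proof.
elim: n e => [|n IH] e; first by rewrite /= pcast1.
have e1 : Posz n = iter n succz 0 by rewrite iter_succz addr0.
by rewrite /= (IH e1) (@fstep_cast (Posz n) _ e1 e) /= compm1.
Qed.

Lemma muN0 n (e : Negz n = iter n.+1 predz 0) X : muN n.+1 0 X = pcast e X.
Proof.
elim: n e => [|n IH] e; first by rewrite pcast1 /= fmap1 compm1.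
have e1 : Negz n = iter n.+1 predz 0 by rewrite iter_predz addr0 NegzE.
rewrite -[LHS]/(gstep (iter n.+1 predz 0) X \c fmap F' (muN n.+1 0 X)).
by rewrite (IH e1) (@gstep_cast (Negz n) _ e1 e) /= compm1.
Qed.

Lemma mu_p0 p (e : p = shiftz p 0) X : mu p 0 X = pcast e X.
Proof. by case: p e => n e; [exact: muP0 | exact: muN0]. Qed.

Lemma mu_0p q X : mu 0 q X = idm (fpow q X).
Proof. by []. Qed.

End Powers.

Section Orbit.
Variables (C : preadditive) (F : autoequivalence C).
Implicit Types (X Y Z W : C).

Definition orbit_hom X Y : zmodType := dsum (fun p : int => hom X (fpow F p Y)).

Definition orbit_id X : orbit_hom X X :=
  dsum_single (A := fun p => hom X (fpow F p X)) 0 (idm X).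

(* For f : X -> F^p Y and g : Y -> F^q Z the composite is
   X -> F^p Y -> F^p F^q Z = F^(p+q) Z, extended bilinearly. *)
Definition orbit_comp1 p q X Y Z (g : hom Y (fpow F q Z))
    (f : hom X (fpow F p Y)) : hom X (fpow F (p + q) Z) :=
  fpowD F p q Z \c (fmap (fpow F p) g \c f).

Definition orbit_comp X Y Z (g : orbit_hom Y Z) (f : orbit_hom X Y) :
    orbit_hom X Z :=
  \sum_(p \in [set: int]) \sum_(q \in [set: int])
    dsum_single (A := fun r => hom X (fpow F r Z)) (p + q)
      (orbit_comp1 (g q) (f p)).

Local Notation single p f :=
  (dsum_single (A := fun r => hom _ (fpow F r _)) p f).

Lemma orbit_comp1Dl p q X Y Z (g g' : hom Y (fpow F q Z))
    (f : hom X (fpow F p Y)) :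
  orbit_comp1 (g + g') f = orbit_comp1 g f + orbit_comp1 g' f.
Proof. by rewrite /orbit_comp1 fmapD compDl compDr. Qed.

Lemma orbit_comp1Dr p q X Y Z (g : hom Y (fpow F q Z))
    (f f' : hom X (fpow F p Y)) :
  orbit_comp1 g (f + f') = orbit_comp1 g f + orbit_comp1 g f'.
Proof. by rewrite /orbit_comp1 !compDr. Qed.

Lemma orbit_comp10l p q X Y Z (f : hom X (fpow F p Y)) :
  orbit_comp1 (0 : hom Y (fpow F q Z)) f = 0.
Proof. by rewrite /orbit_comp1 fmap0 comp0m compm0. Qed.

Lemma orbit_comp10r p q X Y Z (g : hom Y (fpow F q Z)) :
  orbit_comp1 g (0 : hom X (fpow F p Y)) = 0.
Proof. by rewrite /orbit_comp1 !compm0. Qed.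

Lemma orbit_compE X Y Z (g : orbit_hom Y Z) (f : orbit_hom X Y)
    (S S' : {fset int}) :
  (forall p, p \notin S -> f p = 0) -> (forall q, q \notin S' -> g q = 0) ->
  orbit_comp g f
  = \sum_(p <- S) \sum_(q <- S') single (p + q) (orbit_comp1 (g q) (f p)).
Proof.
move=> fS gS'; rewrite /orbit_comp (fsbigTE S) => [|p pS]; last first.
  apply: fsbig1 => q _; rewrite fS // orbit_comp10r; exact: dsum_single0.
apply: eq_bigr => p _; rewrite (fsbigTE S') // => q qS'.
rewrite gS' // orbit_comp10l; exact: dsum_single0.
Qed.

Lemma orbit_compDl X Y Z (g g' : orbit_hom Y Z) (f : orbit_hom X Y) :
  orbit_comp (g + g') f = orbit_comp g f + orbit_comp g' f.
Proof.
case: (dsum_fin f) (dsum_fin g) (dsum_fin g') => S fS [T gT] [T' gT'].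
have gU q : q \notin (T `|` T')%fset -> g q = 0.
  by rewrite inE negb_or => /andP[/gT].
have gU' q : q \notin (T `|` T')%fset -> g' q = 0.
  by rewrite inE negb_or => /andP[_ /gT'].
have gUU q : q \notin (T `|` T')%fset -> (g + g') q = 0.
  by move=> qU; rewrite dsum_valD gU // gU' // addr0.
rewrite (orbit_compE fS gU) (orbit_compE fS gU') (orbit_compE fS gUU).
rewrite -big_split; apply: eq_bigr => p _; rewrite -big_split.
by apply: eq_bigr => q _; rewrite dsum_valD orbit_comp1Dl dsum_singleD.
Qed.

Lemma orbit_compDr X Y Z (g : orbit_hom Y Z) (f f' : orbit_hom X Y) :
  orbit_comp g (f + f') = orbit_comp g f + orbit_comp g f'.
Proof.
case: (dsum_fin g) (dsum_fin f) (dsum_fin f') => S gS [T fT] [T' fT'].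
have fU q : q \notin (T `|` T')%fset -> f q = 0.
  by rewrite inE negb_or => /andP[/fT].
have fU' q : q \notin (T `|` T')%fset -> f' q = 0.
  by rewrite inE negb_or => /andP[_ /fT'].
have fUU q : q \notin (T `|` T')%fset -> (f + f') q = 0.
  by move=> qU; rewrite dsum_valD fU // fU' // addr0.
rewrite (orbit_compE fU gS) (orbit_compE fU' gS) (orbit_compE fUU gS).
rewrite -big_split; apply: eq_bigr => p _; rewrite -big_split.
by apply: eq_bigr => q _; rewrite dsum_valD orbit_comp1Dr dsum_singleD.
Qed.

Lemma orbit_comp0l X Y Z (f : orbit_hom X Y) :
  orbit_comp (0 : orbit_hom Y Z) f = 0.
Proof.
by apply: (@addrI _ (orbit_comp (0 : orbit_hom Y Z) f));
  rewrite -orbit_compDl !addr0.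
Qed.

Lemma orbit_comp0r X Y Z (g : orbit_hom Y Z) :
  orbit_comp g (0 : orbit_hom X Y) = 0.
Proof.
by apply: (@addrI _ (orbit_comp g (0 : orbit_hom X Y)));
  rewrite -orbit_compDr !addr0.
Qed.

Lemma orbit_comp_single p q X Y Z (g : hom Y (fpow F q Z))
    (f : hom X (fpow F p Y)) :
  orbit_comp (single q g) (single p f) = single (p + q) (orbit_comp1 g f).
Proof.
rewrite (@orbit_compE _ _ _ _ _ [fset p]%fset [fset q]%fset); first last.
- by move=> r; rewrite inE eq_sym => /dsum_single_val_neq /= ->.
- by move=> r; rewrite inE eq_sym => /dsum_single_val_neq /= ->.
by rewrite !big_seq_fset1 /= !dsum_single_valE.
Qed.

Lemma single_cast p q (e : p = q) X Y (f : hom X (fpow F p Y)) :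
  single q (pcast F e Y \c f) = single p f.
Proof. by case: _ / e; rewrite /= comp1m. Qed.

Lemma single_comp1 p q X Y Z (g : hom Y (fpow F q Z))
    (f : hom X (fpow F p Y)) :
  single (p + q) (orbit_comp1 g f)
  = single (shiftz p q) (mu F p q Z \c (fmap (fpow F p) g \c f)).
Proof. by rewrite /orbit_comp1 /fpowD -compA single_cast. Qed.

Lemma orbit_compA X Y Z W (h : orbit_hom Z W) (g : orbit_hom Y Z)
    (f : orbit_hom X Y) :
  orbit_comp h (orbit_comp g f) = orbit_comp (orbit_comp h g) f.
Proof.
elim/dsum_ind: h => [|h h' IH IH'|r h]; first by rewrite !orbit_comp0l.
  by rewrite !orbit_compDl IH IH'.
elim/dsum_ind: g => [|g g' IH IH'|q g].
- by rewrite orbit_comp0l !orbit_comp0r orbit_comp0l.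
- by rewrite orbit_compDl !orbit_compDr IH IH' orbit_compDl.
elim/dsum_ind: f => [|f f' IH IH'|p f]; first by rewrite !orbit_comp0r.
  by rewrite !orbit_compDr IH IH'.
rewrite (orbit_comp_single g f) (orbit_comp_single h g).
rewrite !single_comp1 !orbit_comp_single !single_comp1.
have e : shiftz p (shiftz q r) = shiftz (shiftz p q) r.
  by rewrite !shiftzE addrA.
rewrite -(single_cast e); congr (single _ _).
rewrite !fmapM !compA -(mu_assoc F e); congr (_ \c f).
by rewrite -!compA; congr (_ \c _); rewrite !compA mu_nat.
Qed.

Lemma orbit_comp1m X Y (f : orbit_hom X Y) : orbit_comp (orbit_id Y) f = f.
Proof.
elim/dsum_ind: f => [|f f' IH IH'|p f]; first by rewrite orbit_comp0r.
  by rewrite orbit_compDr IH IH'.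
have e : p = shiftz p 0 by rewrite shiftzE addr0.
by rewrite orbit_comp_single single_comp1 (mu_p0 F e) single_cast fmap1 comp1m.
Qed.

Lemma orbit_compm1 X Y (f : orbit_hom X Y) : orbit_comp f (orbit_id X) = f.
Proof.
elim/dsum_ind: f => [|f f' IH IH'|p f]; first by rewrite orbit_comp0l.
  by rewrite orbit_compDl IH IH'.
by rewrite orbit_comp_single single_comp1 mu_0p comp1m compm1.
Qed.

Definition orbit_category : preadditive :=
  @Preadditive C orbit_hom orbit_id orbit_comp orbit_compA orbit_comp1m
    orbit_compm1 orbit_compDl orbit_compDr.

Definition orbit_proj_map X Y (f : hom X Y) : @hom orbit_category X Y :=
  dsum_single (A := fun p => hom X (fpow F p Y)) 0 f.

Definition orbit_proj : additive_functor C orbit_category.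
Proof.
refine (@AdditiveFunctor C orbit_category (fun X => X) orbit_proj_map _ _ _).
- by [].
- move=> X Y Z g f.
  apply: esym; rewrite [LHS](@orbit_comp_single 0 0 X Y Z g f).
  by rewrite single_comp1 mu_0p comp1m.
- by move=> X Y f g; exact: dsum_singleD.
Defined.

End Orbit.

(* Main.v *)
Require Import Defs.
From mathcomp Require Import all_boot.
From mathcomp Require Import ssralg ssrint.

(** A morphism [A -> Z] of the orbit category is a finite sum of morphisms
  [A -> F^p Z] of [T].  If [a] is a right [X]-approximation of [Z] then, as [X]
  is [F]-periodic, [F^p a] is one of [F^p Z] for every [p]; factoring each
  component through [F^p a] shows that [pi a] is a right approximation in the
  orbit category.  Applied to the zero map into [Sigma^i Z], the same argument
  transports the vanishing of [Ext^i] from [T] to the orbit category, and it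
  passes back because [pi] is faithful and commutes with [Sigma]. *)

(* [Defs] comes last so that [compA] is not [ssrfun.compA]. *)
Import GRing.Theory Defs.

Set Implicit Arguments.
Unset Strict Implicit.

Lemma isomorphic_refl (C : preadditive) (X : C) : isomorphic X X.
Proof. by exists (idm X), (idm X); rewrite comp1m. Qed.

Lemma isomorphic_fmap (C D : preadditive) (P : additive_functor C D) (X Y : C) :
  isomorphic X Y -> isomorphic (P X) (P Y).
Proof.
by move=> [f [g [gf fg]]]; exists (fmap P f), (fmap P g); rewrite -!fmapM gf fg !fmap1.
Qed.

(** Kept transparent so that its components reduce to [nisoV e] when the unit is inverted below. *)
Lemma nat_iso_sym (C D : preadditive) (P Q : additive_functor C D) :
  nat_iso P Q -> nat_iso Q P.
Proof.
move=> e; exists (nisoV e) e => [A B f|A|A]; [|exact: nisoVK|exact: nisoK].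
rewrite -[LHS]compm1 -(nisoVK e A) compA -(compA _ _ (e A)) -(niso_nat e).
by rewrite (compA (nisoV e B)) nisoK comp1m.
Defined.

Lemma isomorphic_hom0 (C : preadditive) (A A' Z Z' : C) :
  isomorphic A A' -> isomorphic Z Z' ->
  (forall e : hom A Z, e = 0%R) -> forall e : hom A' Z', e = 0%R.
Proof.
move=> [a [a' [_ aa']]] [z [z' [_ zz']]] AZ0 e.
have -> : e = z \c (z' \c e \c a) \c a'.
  by rewrite -!compA aa' compm1 compA zz' comp1m.
by rewrite (AZ0 (z' \c e \c a)) compm0 comp0m.
Qed.

Lemma fiter_Susp_proj (C D : preadditive) (tC : triangulation C)
    (tD : triangulation D) (P : additive_functor C D) :
  is_triangle_functor tC tD P -> forall (i : nat) (Z : C),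
  isomorphic (P (fiter (Susp tC) i Z)) (fiter (Susp tD) i (P Z)).
Proof.
move=> [phi _]; elim=> [|i IH] Z; first exact: isomorphic_refl.
apply: isomorphic_trans (isomorphic_fmap (Susp tD) (IH Z)).
pose W := fiter (Susp tC) i Z; exists (phi W), (nisoV phi W).
by split; [exact: (nisoK phi W) | exact: (nisoVK phi W)].
Qed.

Section Approximation.
Variables (C : preadditive) (X : subcategory C).

Definition right_approx (A Z : C) (a : hom A Z) : Prop :=
  forall (B : C) (g : hom B Z), X B -> exists h : hom B A, g = a \c h.

Lemma right_approx0 (W Z : C) :
  right_approx (0%R : hom W Z) <-> forall B, X B -> forall g : hom B Z, g = 0%R.
Proof.
split=> [Z0 B XB g|Z0 B g XB]; first by have [h ->] := Z0 B g XB; rewrite comp0m.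
by exists 0%R; rewrite comp0m; exact: Z0.
Qed.

(* The hypothesis on [P (n Z)] is a triangle identity, with [n] the inverse of the unit. *)
Lemma right_approx_fmap (P Q : additive_functor C C)
    (e : nat_iso (comp_functor P Q) (id_functor C))
    (n : forall Z, hom (Q (P Z)) Z) :
  (forall Z, fmap P (n Z) = e (P Z)) -> (forall B, X B -> X (Q B)) ->
  forall (A Z : C) (a : hom A Z), right_approx a -> right_approx (fmap P a).
Proof.
move=> Pn XQ A Z a apa B g XB.
(* The adjunct of [g] factors through [a]; applying [P] and undoing [e] turns this into a
   factorization of [g]. *)
have [h nh] := apa _ (n Z \c fmap Q g) (XQ _ XB).
exists (fmap P h \c nisoV e B).
rewrite compA -fmapM -nh fmapM Pn.
have /= -> := niso_nat e g.
by rewrite -compA; have /= -> := nisoVK e B; rewrite compm1.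
Qed.

Variable F : autoequivalence C.
Hypothesis periodicX : periodic F X.

Lemma periodic_aeq (Z : C) : X Z -> X (F Z).
Proof. by move=> XZ; apply/periodicX; exists Z => //; exact: isomorphic_refl. Qed.

Lemma periodic_aeqV (Z : C) : X Z -> X (aeqV F Z).
Proof.
move=> /periodicX[A XA FAZ]; apply: subcat_iso XA.
apply: isomorphic_trans (isomorphic_fmap (aeqV F) FAZ).
exists (aeq_unit F A), (nisoV (aeq_unit F) A).
by split; [exact: (nisoK (aeq_unit F) A) | exact: (nisoVK (aeq_unit F) A)].
Qed.

Lemma periodic_fpow (p : int) (Z : C) : X Z -> X (fpow F p Z).
Proof.
case: p => n XZ; first by elim: n => //= n; exact: periodic_aeq.
by rewrite /fpow; elim: n.+1 => //= k; exact: periodic_aeqV.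
Qed.

Lemma right_approx_fpow (p : int) (A Z : C) (a : hom A Z) :
  right_approx a -> right_approx (fmap (fpow F p) a).
Proof.
have apF (A' Z' : C) (b : hom A' Z') : right_approx b -> right_approx (fmap F b).
  exact: (right_approx_fmap (F_etaV F) periodic_aeqV).
have apV (A' Z' : C) (b : hom A' Z') :
    right_approx b -> right_approx (fmap (aeqV F) b).
  (* Now the quasi-inverse plays [P]: the inverse unit serves as [e] and the counit as [n]. *)
  apply: (right_approx_fmap (e := nat_iso_sym (aeq_unit F)) (n := aeq_counit F)
            _ periodic_aeq) => W.
  exact: F'_cou.
case: p => n apa; first by elim: n => //= n; exact: apF.
by rewrite /fpow; elim: n.+1 => //= k; exact: apV.
Qed.

End Approximation.

Section OrbitApproximation.
Variables (C : preadditive) (F : autoequivalence C) (X : subcategory C).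
Hypothesis periodicX : periodic F X.

Local Notation O := (orbit_category F).
Local Notation pi := (orbit_proj F).
Local Notation Y := (image_subcategory pi X).

Lemma image_proj (A : C) : X A -> Y A.
Proof. by move=> XA; exists A => //; exact: isomorphic_refl. Qed.

Lemma orbit_proj_inj (A B : C) (f : hom A B) : fmap pi f = 0%R -> f = 0%R.
Proof.
move=> f0; rewrite -(@dsum_single_valE _ (fun p => hom A (fpow F p B)) (Posz 0) f).
exact: (congr1 (fun x : orbit_hom F A B => x (Posz 0)) f0).
Qed.

Lemma proj_right_approx (A Z : C) (a : hom A Z) :
  right_approx X a -> right_approx Y (fmap pi a).
Proof.
move=> apa B g [B' XB' [u [v [_ uv]]]].
suff [h E] : exists h : @hom O B' A, g \c u = fmap pi a \c h.
  by exists (h \c v); rewrite compA -E -compA uv compm1.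
(* Maps factoring through [pi a] form a subgroup, so a homogeneous [x : B' -> F^p Z] suffices. *)
elim/dsum_ind: (g \c u) => [|x y [h ->] [k ->]|p x].
- by exists 0%R; rewrite compm0.
- by exists (h + k)%R; rewrite compDr.
have [h ->] := right_approx_fpow periodicX apa x XB'.
exists (dsum_single p h).
(* As [pi a] has degree 0, the composite has degree [shiftz p 0], which is [p] up to a cast. *)
have e : p = shiftz p 0 by rewrite shiftzE addr0.
by rewrite [RHS]orbit_comp_single single_comp1 (mu_p0 F e) single_cast.
Qed.

(** Here [F^p] acts on the target: a component [Z -> F^p B'] ends in [X] by periodicity, so it
    factors through [a] itself. *)
Lemma proj_left_approx (A Z : C) (a : hom Z A) :
  (forall (B : C) (g : hom Z B), X B -> exists h : hom A B, g = h \c a) ->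
  forall (B : O) (g : @hom O Z B), Y B -> exists h : @hom O A B, g = h \c fmap pi a.
Proof.
move=> apa B g [B' XB' [u [v [_ uv]]]].
suff [h E] : exists h : @hom O A B', v \c g = h \c fmap pi a.
  by exists (u \c h); rewrite -compA -E compA uv comp1m.
elim/dsum_ind: (v \c g) => [|x y [h ->] [k ->]|p x].
- by exists 0%R; rewrite comp0m.
- by exists (h + k)%R; rewrite compDl.
have [h ->] := apa _ x (periodic_fpow periodicX p XB').
exists (dsum_single p h).
by rewrite [RHS]orbit_comp_single single_comp1 mu_0p comp1m.
Qed.

Lemma proj_hom0 (Z : C) :
  (forall A, X A -> forall e : hom A Z, e = 0%R) ->
  forall A, Y A -> forall e : @hom O A Z, e = 0%R.
Proof.
move=> Z0; apply/(right_approx0 Y Z (Z : O)); rewrite -(fmap0 pi).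
by apply: proj_right_approx; apply/right_approx0.
Qed.

End OrbitApproximation.

Theorem lemma6 (T : preadditive) (tT : triangulation T) (lf : locally_finite T)
  (F : autoequivalence T) (tO : triangulation (orbit_category F))
  (triangle_proj : is_triangle_functor tT tO (orbit_proj F))
  (m : nat) (m_ge1 : (1 <= m)%N) (X : subcategory T)
  (periodicX : periodic F X) (tiltingX : cluster_tilting tT m X) :
  cluster_tilting tO m (image_subcategory (orbit_proj F) X).
Proof.
have [[contraX coX] Xr Xl] := tiltingX.
have SuspE := fiter_Susp_proj triangle_proj.
pose Y := image_subcategory (orbit_proj F) X.
have ExtT (i : nat) (A Z : T) :
    (forall e : Ext tO i (A : orbit_category F) Z, e = 0%R) ->
    forall e : Ext tT i A Z, e = 0%R.
  move=> AZ0 e; apply: orbit_proj_inj.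
  exact: isomorphic_hom0 (isomorphic_refl _) (isomorphic_sym (SuspE i Z)) AZ0 _.
(* Rigidity of [Y], the forward half of both orthogonality conditions: up to isomorphism the target
   is [pi (Sigma^i Z')] with [Z'] in [X]. *)
have ExtY (i : nat) (A Z : orbit_category F) :
    (0 < i < m)%N -> Y A -> Y Z -> forall e : Ext tO i A Z, e = 0%R.
  move=> im YA [Z' XZ' Z'Z].
  apply: (isomorphic_hom0 (isomorphic_refl A)
            (isomorphic_fmap (fiter (Susp tO) i) Z'Z)).
  apply: (isomorphic_hom0 (isomorphic_refl A) (SuspE i Z')).
  by apply: (proj_hom0 periodicX) YA; have /Xr := XZ'; apply.
split.
- split=> Z.
    have [A [a [XA apa]]] := contraX Z; exists A, (fmap (orbit_proj F) a).
    by split; [exact: image_proj | exact: proj_right_approx].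
  have [A [a [XA apa]]] := coX Z; exists A, (fmap (orbit_proj F) a).
  by split; [exact: image_proj | exact: proj_left_approx].
- move=> Z; split=> [YZ i im A YA|Z0]; first exact: ExtY.
  (* [Z] is also an object of [T], so it is enough to show [X Z], by testing Ext in [T]. *)
  by apply/image_proj/Xr => i im A XA; apply/ExtT/Z0 => //; exact: image_proj.
- move=> Z; split=> [YZ i im A YA|Z0]; first exact: ExtY.
  by apply/image_proj/Xl => i im A XA; apply/ExtT/Z0 => //; exact: image_proj.
Qed.
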